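(* Graph reconciliation (with unlimited computation for both parties) can be solved with probability at least $1-1/n$ using one round of $O(d\log n)$ bits of communication.
   Context: Graph reconciliation (one-way): Alice and Bob hold unlabeled graphs $G_A=(V_A,E_A)$ and $G_B=(V_B,E_B)$ with $|V_A|=|V_B|=n$, such that at most $d$ edge additions/deletions to $G_B$ yield a graph isomorphic to $G_A$. At the end of the protocol Bob must hold a graph isomorphic to $G_A$. Here Alice and Bob have unlimited computational power; they share public random coins at no communication cost; one round is a single message from Alice to Bob. *)

(* Defs.v *)
From HB Require Import structures.
From mathcomp Require Import all_boot all_order all_algebra.
From mathcomp Require Import boolp reals.

Set Implicit Arguments.
Unset Strict Implicit.
Unset Printing Implicit Defensive.

Import GRing.Theory.
Local Open Scope ring_scope.

Definition simple_edges (V : finType) (E : {set {set V}}) : bool :=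
  [forall e in E, #|e| == 2].

Record sgraph (V : finType) := SGraph {
  edges :> {set {set V}};
  edgesP : simple_edges edges
}.

HB.instance Definition _ (V : finType) := [isSub for @edges V].
HB.instance Definition _ (V : finType) := [Finite of sgraph V by <:].

Definition isomorphic (V W : finType) (G : sgraph V) (H : sgraph W) : Prop :=
  exists2 f : V -> W, bijective f & edges H = [set f @: (e : {set V}) | e in edges G].

Definition edited_to (d : nat) (V : finType) (G H : sgraph V) : Prop :=
  exists add del : {set {set V}},
    (#|add| + #|del| <= d)%N /\ edges H = (edges G :\: del) :|: add.

(* The two vertex types are unrelated: no correspondence between the vertices
   of GB and those of GA is given. *)
Definition reconcilable (d : nat) (VA VB : finType)
    (GA : sgraph VA) (GB : sgraph VB) : Prop :=
  exists2 H : sgraph VB, edited_to d GB H & isomorphic H GA.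

(* Both parties read the same [ncoins] fair public coins, which are not part
   of the [nbits]-bit message.  No computability is required of [alice] and
   [bob], and neither sees the other party's graph or vertex set. *)
Record protocol := Protocol {
  ncoins : nat;
  nbits : nat;
  alice : ncoins.-tuple bool ->
    forall VA : finType, sgraph VA -> nbits.-tuple bool;
  bob : ncoins.-tuple bool -> nbits.-tuple bool ->
    forall VB : finType, sgraph VB -> sgraph VB
}.

Definition success_prob (R : realType) (P : protocol) (VA VB : finType)
    (GA : sgraph VA) (GB : sgraph VB) : R :=
  #|[pred w : (ncoins P).-tuple bool | `[< isomorphic (bob w (alice w GA) GB) GA >]]|%:R
    / #|{: (ncoins P).-tuple bool}|%:R.

(* Main.v *)
(** Alice sends a [k]-bit random hash of the isomorphism class of [GA], with
    [2 ^ k >= n ^ (3 * d)], and Bob outputs any graph within [d] edits of [GB]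
    whose class has the same hash.  At most [n ^ (2 * d)] graphs lie within [d]
    edits of [GB]; at least one of them is isomorphic to [GA], and each of the
    at most [n ^ (2 * d) - 1] others collides with probability [2 ^ - k].
    Not counting the good candidate makes the bound hold for [d = 0] too, where
    no bit may be sent. *)
Require Import Defs.
From mathcomp Require Import all_boot all_order all_algebra.
From mathcomp Require Import boolp reals exp.
From mathcomp Require Import zify ring.

Set Implicit Arguments.
Unset Strict Implicit.
Unset Printing Implicit Defensive.

Import Order.TTheory GRing.Theory Num.Theory.
Local Open Scope ring_scope.

Lemma isomorphic_sym (V W : finType) (G : sgraph V) (H : sgraph W) :
  isomorphic G H -> isomorphic H G.
Proof.
case=> f [g fK gK] eH; exists g; first by exists f.
rewrite eH -imset_comp -[LHS]imset_id; apply: eq_imset => e /=.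
by rewrite -imset_comp -[LHS]imset_id; apply: eq_imset => x /=; rewrite fK.
Qed.

Lemma isomorphic_trans (U V W : finType)
    (G : sgraph U) (H : sgraph V) (K : sgraph W) :
  isomorphic G H -> isomorphic H K -> isomorphic G K.
Proof.
case=> f fb eH [g gb eK]; exists (g \o f); first exact: bij_comp.
rewrite eK eH -imset_comp; apply: eq_imset => e /=.
by rewrite -imset_comp.
Qed.

Lemma bijection_of_card (T U : finType) :
  #|T| = #|U| -> exists f : T -> U, bijective f.
Proof.
move=> eTU; exists (fun x => enum_val (cast_ord eTU (enum_rank x))).
exists (fun y => enum_val (cast_ord (esym eTU) (enum_rank y))) => x.
  by rewrite enum_valK cast_ordK enum_rankK.
by rewrite enum_valK cast_ordKV enum_rankK.
Qed.

Lemma isomorphic_ord (n : nat) (V : finType) (G : sgraph V) :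
  #|V| = n -> exists K : sgraph 'I_n, isomorphic G K.
Proof.
move=> cV; have [f fb] : exists f : V -> 'I_n, bijective f.
  by apply: bijection_of_card; rewrite card_ord.
have simpleK : simple_edges [set f @: (e : {set V}) | e in edges G].
  apply/forall_inP => _ /imsetP[e eG ->].
  by rewrite card_imset ?(forall_inP (edgesP G)) //; exact: bij_inj.
by exists (SGraph simpleK), f.
Qed.

(** Representing a class by its members on ['I_n] puts graphs on unrelated vertex types into one
    finite type, so that both parties can evaluate the same hash function. *)
Definition iso_class (n : nat) (V : finType) (G : sgraph V) :
    {set sgraph 'I_n} :=
  [set K | `[< isomorphic G K >]].

Lemma iso_class_isomorphic (n : nat) (V W : finType)
    (G : sgraph V) (H : sgraph W) :
  isomorphic G H -> iso_class n G = iso_class n H.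
Proof.
move=> GH; apply/setP => K; rewrite !inE; apply/asboolP/asboolP.
  exact/isomorphic_trans/isomorphic_sym.
exact: isomorphic_trans.
Qed.

(** The cardinality hypothesis makes the class of [G] nonempty; any member of it is a common copy
    linking the two graphs. *)
Lemma isomorphic_iso_class (n : nat) (V W : finType)
    (G : sgraph V) (H : sgraph W) :
  #|V| = n -> iso_class n G = iso_class n H -> isomorphic G H.
Proof.
move=> /(isomorphic_ord G)[K GK] /setP/(_ K); rewrite !inE.
rewrite (asboolT GK) => /esym/asboolP HK.
exact/(isomorphic_trans GK)/isomorphic_sym.
Qed.

(** Coding edits by ordered pairs makes the later count immediate: a list of length [d] has
    [(#|V| ^ 2) ^ d] possible values. *)
Definition toggled_edges (V : finType) (G : sgraph V) (t : seq (V * V)) :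
    {set {set V}} :=
  [set e | (e \in edges G) (+)
     ((#|e| == 2) && (e \in [seq [set p.1; p.2] | p <- t]))].

(** The symmetric difference of the two edge sets lies in [add :|: del], so it has at most [d]
    elements, and each is a pair because it is an edge of [G] or of [H]. *)
Lemma edited_to_toggled (d : nat) (V : finType) (G H : sgraph V) :
  (0 < #|V|)%N -> edited_to d G H ->
  exists t : d.-tuple (V * V), edges H = toggled_edges G t.
Proof.
move=> /card_gt0P[x0 _] [add [del [le_d eH]]].
pose S := [set e | (e \in edges G) (+) (e \in edges H)].
have S_small : (#|S| <= d)%N.
  apply: leq_trans le_d; apply: leq_trans (leq_card_setU add del).
  apply/subset_leq_card/subsetP => e; rewrite !inE eH !inE.
  by case: (e \in edges G); case: (e \in add); case: (e \in del).
have S2 e : e \in S -> #|e| == 2.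
  rewrite inE; case eG: (e \in edges G) => /=.
    by rewrite (forall_inP (edgesP G)).
  exact: (forall_inP (edgesP H)).
(* Loops [(x, x)] encode no edge, so they can pad the list to length [d]. *)
pose ends (e : {set V}) :=
  odflt (x0, x0) [pick p : V * V | e == [set p.1; p.2]].
have endsK e : e \in S -> [set (ends e).1; (ends e).2] = e.
  move=> /S2/cards2P[x [y [_ exy]]]; rewrite /ends.
  by case: pickP => [p /eqP //|/(_ (x, y))]; rewrite exy eqxx.
exists [tuple nth (x0, x0) (map ends (enum S)) i | i < d].
apply/setP => e; rewrite inE.
suff -> : (#|e| == 2) && (e \in [seq [set p.1; p.2] |
    p <- [tuple nth (x0, x0) (map ends (enum S)) i | i < d]]) = (e \in S).
  by rewrite inE addbA addbb.
apply/andP/idP => [[e2 /mapP[p /mapP[i _ ->]] ee]|eS]; last first.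
  split; first exact: S2.
  have lt_eS : (index e (enum S) < size (enum S))%N.
    by rewrite index_mem mem_enum.
  have lt_ed : (index e (enum S) < d)%N.
    by apply: leq_trans lt_eS _; rewrite -cardE.
  apply/mapP; exists (ends e); last by rewrite endsK.
  apply/mapP; exists (Ordinal lt_ed); first by rewrite mem_enum.
  by rewrite /= (nth_map e) // nth_index // mem_enum.
have [ltiS|geiS] := ltnP i (size (enum S)).
  have := mem_nth e ltiS; rewrite mem_enum => memS.
  by rewrite ee (nth_map e) // endsK.
by move: e2; rewrite ee nth_default ?size_map //= setUid cards1.
Qed.

Lemma card_edited_to (d : nat) (V : finType) (G : sgraph V) :
  (0 < #|V|)%N ->
  (#|[set H | `[< edited_to d G H >]]| <= #|V| ^ (2 * d))%N.
Proof.
move=> V0; rewrite -(card_imset _ (val_inj : injective (@edges V))).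
pose toggle (t : d.-tuple (V * V)) := toggled_edges G t.
apply: (@leq_trans #|toggle @: setT|).
  apply/subset_leq_card/subsetP => _ /imsetP[H + ->].
  rewrite inE => /asboolP/(edited_to_toggled V0)[t ->].
  by apply/imsetP; exists t.
apply: leq_trans (leq_imset_card _ _) _.
by rewrite cardsT card_tuple card_prod expnM mulnn.
Qed.

Lemma leq_card_bigcup (I T : finType) (P : pred I) (F : I -> {set T}) :
  (#|\bigcup_(i | P i) F i| <= \sum_(i | P i) #|F i|)%N.
Proof.
elim/big_ind2: _ => [|A a B b leA leB|//]; first by rewrite cards0.
by apply: leq_trans (leq_add leA leB); exact: leq_card_setU.
Qed.

Lemma card_collision (T S : finType) (x y : T) :
  x != y ->
  (#|[set h : {ffun T -> S} | h x == h y]| * #|S| <= #|{ffun T -> S}|)%N.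
Proof.
move=> xy; rewrite -[#|S|]cardsT -cardsX.
(* A collision [h] and a value [s] are recovered from [h] with [h x]
   overwritten by [s], because [h x] is stored once more as [h y]. *)
pose overwrite (hs : {ffun T -> S} * S) :=
  [ffun z => if z == x then hs.2 else hs.1 z].
apply: (@leq_card_in _ _ overwrite).
move=> [h s] [h' s']; rewrite !inE /= !andbT => /eqP hxy /eqP h'xy.
move=> /ffunP eq_ow; have /= := eq_ow x; rewrite !ffunE eqxx /= => <-.
suff -> : h = h' by [].
have eq_out z : z != x -> h z = h' z.
  by move=> /negbTE zx; have := eq_ow z; rewrite !ffunE zx.
apply/ffunP => z; have [->|/eq_out//] := eqVneq z x.
by rewrite hxy h'xy eq_out // eq_sym.
Qed.

(** A bijective [hash] turns uniform coins into a uniformly random function. The default [GB] only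
    makes Bob's output total. *)
Definition hash_protocol (n d k m : nat)
    (hash : m.-tuple bool -> {ffun {set sgraph 'I_n} -> k.-tuple bool}) :
    protocol :=
  @Protocol m k (fun w VA GA => hash w (iso_class n GA))
    (fun w msg VB GB => odflt GB
      [pick H | `[< edited_to d GB H >] && (hash w (iso_class n H) == msg)]).

(** A union bound over the wrong candidates, with the denominators of the probabilities cleared so
    that it is a count of coin strings. *)
Lemma card_hash_protocol_failure (n d k m : nat)
    (hash : m.-tuple bool -> {ffun {set sgraph 'I_n} -> k.-tuple bool})
    (P := hash_protocol d hash)
    (VA VB : finType) (GA : sgraph VA) (GB : sgraph VB) :
  bijective hash -> (0 < n)%N -> #|VB| = n -> reconcilable d GA GB ->
  (#|[set w | ~~ `[< isomorphic (bob (p := P) w (alice (p := P) w GA) GB) GA >]]|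
     * 2 ^ k <= (n ^ (2 * d)).-1 * 2 ^ m)%N.
Proof.
move=> hash_bij n0 cVB [H0 edH0 isoH0].
pose E := [set H | `[< edited_to d GB H >]] :\ H0.
have cE : (#|E| <= (n ^ (2 * d)).-1)%N.
  have := @card_edited_to d _ GB; rewrite cVB (cardsD1 H0) inE asboolT //.
  by move=> /(_ n0); rewrite -/E; case: (n ^ _)%N.
pose other := [set H in E | iso_class n H != iso_class n GA].
pose coll (H : sgraph VB) :=
    [set w | hash w (iso_class n H) == hash w (iso_class n GA)].
have ccoll H : H \in other -> (#|coll H| * 2 ^ k <= 2 ^ m)%N.
  rewrite inE => /andP[_ /card_collision-/(_ (k.-tuple bool))].
  (* Through the bijection [hash], counting colliding coin strings reduces to counting colliding
     functions. *)
  rewrite -(bij_eq_card hash_bij) !card_tuple card_bool; apply: leq_trans.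
  rewrite leq_mul2r -(card_imset _ (bij_inj hash_bij)); apply/orP; right.
  by apply/subset_leq_card/subsetP => _ /imsetP[w + ->]; rewrite !inE.
apply: (@leq_trans (\sum_(H in other) #|coll H| * 2 ^ k)%N).
  rewrite -big_distrl leq_mul2r; apply/orP; right.
  apply: leq_trans (leq_card_bigcup (mem other) coll).
  apply/subset_leq_card/subsetP => w.
  rewrite inE; apply: contraR => wNcoll; apply/asboolP.
  (* The search cannot come up empty, since [H0] passes it. A pick outside the class of [GA] differs
     from [H0], so it lies in [other] and [w] is one of its collisions. *)
  rewrite /P /=; case: pickP => [H /andP[edH hashH]|/(_ H0)]; last first.
    by rewrite asboolT //= (iso_class_isomorphic n isoH0) eqxx.
  apply: (isomorphic_iso_class cVB); apply/eqP; apply: contraNT wNcoll => neH.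
  apply/bigcupP; exists H; last by rewrite inE.
  rewrite !inE edH neH !andbT; apply: contraNneq neH => ->.
  by rewrite (iso_class_isomorphic n isoH0).
apply: (@leq_trans (\sum_(H in other) 2 ^ m)%N); first exact: leq_sum.
rewrite sum_nat_const leq_mul2r (leq_trans _ cE) ?orbT //.
by apply/subset_leq_card/subsetP => H; rewrite inE => /andP[].
Qed.

(** Rounding the binary logarithm up instead of down adds at most 1, which at most doubles it once
    [n >= 2]; for [n = 1] both sides vanish. *)
Lemma up_log_le_ln (R : realType) (n : nat) :
  (0 < n)%N -> (up_log 2 n)%:R * ln 2 <= 2 * ln n%:R :> R.
Proof.
case: n => [//|[|n]] _; first by rewrite up_log1 ln1 mul0r mulr0.
set N := n.+2; have le_log : (up_log 2 N <= 2 * trunc_log 2 N)%N.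
  have tpos : (0 < trunc_log 2 N)%N by rewrite trunc_log_gt0.
  apply: (@leq_trans (trunc_log 2 N).+1); last by lia.
  apply: up_log_min => //; apply: ltnW; exact: trunc_log_ltn.
have le_ln : (trunc_log 2 N)%:R * ln 2 <= ln N%:R :> R.
  rewrite mulr_natl -lnXn // ler_ln ?posrE ?exprn_gt0 ?ltr0n //.
  by rewrite -natrX ler_nat trunc_logP.
apply: (@le_trans _ _ ((2 * trunc_log 2 N)%:R * ln 2)).
  by rewrite ler_wpM2r ?ler_nat // ln_ge0 // ler1n.
by rewrite natrM -mulrA ler_wpM2l.
Qed.

Theorem theorem16 (R : realType) :
  exists C : R, 0 < C /\
  forall n d : nat, (0 < n)%N ->
  exists P : protocol,
    (nbits P)%:R <= C * d%:R * ln n%:R /\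
    forall (VA VB : finType) (GA : sgraph VA) (GB : sgraph VB),
      #|VA| = n -> #|VB| = n ->
      reconcilable d GA GB ->
      1 - n%:R^-1 <= success_prob R P GA GB.
Proof.
have ln2 : 0 < ln 2 :> R by rewrite ln_gt0 // ltr1n.
(* The 6 is the 3 in [k] times the rounding loss 2 of [up_log_le_ln]; [ln 2] changes the base. *)
exists (6 / ln 2); split=> [|n d n0]; first by rewrite divr_gt0.
pose k := (3 * d * up_log 2 n)%N.
(* The coins spell out the full table of a function, [k] bits for each argument. *)
pose m := (k * #|{set sgraph 'I_n}|)%N.
have [hash hash_bij] :
    exists hash : m.-tuple bool -> {ffun {set sgraph 'I_n} -> k.-tuple bool},
      bijective hash.
  apply: bijection_of_card.
  by rewrite card_ffun !card_tuple card_bool expnM.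
pose P := hash_protocol d hash; exists P; split=> [|VA VB GA GB _ cVB recAB].
  have -> : 6 / ln 2 * d%:R * ln n%:R = (3 * d%:R) * (2 * ln n%:R / ln 2) :> R.
    by field; exact: lt0r_neq0.
  rewrite /= /k natrM natrM ler_wpM2l ?mulr_ge0 ?ler_pdivlMr //.
  exact: up_log_le_ln.
(* This brings the failure probability down to [1 / n]. For [d = 0] the predecessor is 0; otherwise
   [2 * d + 1 <= 3 * d]. *)
have le_k : ((n ^ (2 * d)).-1 * n <= 2 ^ k)%N.
  rewrite /k; have [->|d0] := posnP d; first by rewrite muln0.
  apply: (@leq_trans (n ^ (3 * d))).
    rewrite (@leq_trans (n ^ (2 * d) * n)) ?leq_mul2r ?leq_pred ?orbT //.
    by rewrite -expnSr leq_pexp2l //; lia.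
  by rewrite [(_ * up_log 2 n)%N]mulnC (expnM 2) leq_exp2r ?muln_gt0 ?up_logP.
have := card_hash_protocol_failure hash_bij n0 cVB recAB.
rewrite /success_prob card_tuple card_bool.
set bad := #|_|; set good := #|_| => le_bad.
have gb : (bad + good = 2 ^ m)%N.
  have <- : #|{: m.-tuple bool}| = (2 ^ m)%N by rewrite card_tuple card_bool.
  rewrite addnC -(cardC [pred w : m.-tuple bool | `[< isomorphic
    (bob (p := P) w (alice (p := P) w GA) GB) GA >]]).
  by congr (_ + _)%N; apply: eq_card => w; rewrite !inE.
have le_bad_n : (bad * n <= 2 ^ m)%N.
  rewrite -(leq_pmul2r (expn_gt0 2 k)) mulnAC.
  apply: (leq_trans (leq_mul le_bad (leqnn n))).
  by rewrite mulnAC mulnC leq_mul2l le_k orbT.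
rewrite ler_pdivlMr ?ltr0n ?expn_gt0 // mulrBl mul1r lerBlDl.
rewrite -{1}gb natrD lerD2r.
by rewrite mulrC ler_pdivlMr ?ltr0n // -natrM ler_nat.
Qed.
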